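(* Let $U$ be a coordinate chart of an $n$-dimensional differentiable manifold and let $\nabla$ be a torsion free noncommutative left connection on $U$, i.e. $\nabla_iE_j=\nabla_jE_i$ for all $i,j$. Then the first (algebraic) Bianchi identity $$\mathcal{R}_{E_iE_j}E_k+\mathcal{R}_{E_jE_k}E_i+\mathcal{R}_{E_kE_i}E_j=0$$ and the second (differential) Bianchi identity $$(\nabla_i\mathcal{R})_{E_jE_k}E_p+(\nabla_j\mathcal{R})_{E_kE_i}E_p+(\nabla_k\mathcal{R})_{E_iE_j}E_p=0$$ hold for $1\le i,j,k,p\le n$.
   Context: Indices range over $1,\dots,n$, with the Einstein summation convention. $U$ has coordinates $(x^1,\dots,x^n)$, $\partial_i=\partial/\partial x^i$. $\mathcal{A}_U=C^\infty(U)[[\hbar]]$ with real smooth coefficients. Fix a constant real skew-symmetric $n\times n$ matrix $(\theta^{ij})$; the Moyal product is $(u*v)(x)=\big[\exp(\hbar\theta^{ij}\partial_i\partial'_j)u(x)v(x')\big]_{x=x'}$ for $u,v\in C^\infty(U)$, extended $\mathbb{R}[[\hbar]]$-bilinearly to $\mathcal{A}_U$ (formal series in $\hbar$ being multiplied degree by degree); it is associative and $\partial_i$ satisfies the Leibniz rule for it. $\mathcal{T}_U$ is the free left $(\mathcal{A}_U,* )$-module with basis $E_1,\dots,E_n$, $E_i=\partial_i$. A noncommutative left connection is given by its covariant derivatives, $\mathbb{R}[[\hbar]]$-linear maps $\nabla_i=\nabla_{E_i}:\mathcal{T}_U\to\mathcal{T}_U$ with $\nabla_i(f*V)=(\partial_if)*V+f*\nabla_iV$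 for $f\in\mathcal{A}_U$, $V\in\mathcal{T}_U$. For $V=a^i*E_i\in\mathcal{T}_U$ set $\nabla_VX=a^i*\nabla_iX$. Curvature operators: $\mathcal{R}_{E_iE_j}=\nabla_i\nabla_j-\nabla_j\nabla_i:\mathcal{T}_U\to\mathcal{T}_U$. More generally, when $V=E_i$ or $W=E_j$ one sets $\mathcal{R}_{VW}=\nabla_V\nabla_W-\nabla_W\nabla_V-\nabla_{[V,W]}$, where $[E_i,a^j*E_j]=(\partial_ia^j)*E_j$ and $[a^i*E_i,E_j]=-(\partial_ja^i)*E_i$ for $a^i\in\mathcal{A}_U$ (this gives $\mathcal{R}_{E_i(a^j*E_j)}=a^j*\mathcal{R}_{E_iE_j}$ and $\mathcal{R}_{(a^i*E_i)E_j}=a^i*\mathcal{R}_{E_iE_j}$). The covariant derivative of the curvature operator is $$(\nabla_k\mathcal{R})_{E_iE_j}E_p=\nabla_k(\mathcal{R}_{E_iE_j}E_p)-\mathcal{R}_{(\nabla_kE_i)E_j}E_p-\mathcal{R}_{E_i(\nabla_kE_j)}E_p-\mathcal{R}_{E_iE_j}(\nabla_kE_p).$$ *)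

(* Defs.v *)
From HB Require Import structures.
From mathcomp Require Import all_boot all_order all_algebra.
From mathcomp Require Import all_classical all_reals all_analysis.

Set Implicit Arguments.
Unset Strict Implicit.
Unset Printing Implicit Defensive.

Import Order.TTheory GRing.Theory Num.Theory numFieldNormedType.Exports.

Local Open Scope classical_set_scope.
Local Open Scope ring_scope.

(* A chart is identified with the open subset of R^n over which its
   coordinates (x^1, ..., x^n) range. *)
Record chart (R : realType) (n : nat) := Chart {
  chart_set :> set 'rV[R]_n;
  chart_open : open chart_set }.

Section SmoothFunctions.
Variables (R : realType) (n : nat).
Implicit Types (A : set 'rV[R]_n) (f g : 'rV[R]_n -> R) (s : seq 'I_n).

Definition dpart (i : 'I_n) f : 'rV[R]_n -> R := 'D_(delta_mx 0 i) f.

Definition dparts s f : 'rV[R]_n -> R := foldr dpart f s.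

Definition smooth_on A f : Prop :=
  forall s x, A x ->
    {for x, continuous (dparts s f)} /\
    (forall i, derivable (dparts s f) x (delta_mx 0 i)).

Definition zero_ext A f : 'rV[R]_n -> R := patch (fun=> 0) A f.

Definition smooth_fun_pred (U : chart R n) : {pred 'rV[R]_n -> R} :=
  [pred f : 'rV[R]_n -> R |
    `[< smooth_on U f /\ (forall x, ~ chart_set U x -> f x = 0) >]].

Lemma zero_extT A f x : A x -> zero_ext A f x = f x.
Proof. by move=> Ax; rewrite /zero_ext patchT ?inE. Qed.

Lemma zero_extN A f x : ~ A x -> zero_ext A f x = 0.
Proof. by move=> Ax; rewrite /zero_ext /patch memNset. Qed.

Section Open.
Variable U : chart R n.
Local Notation A := (chart_set U).

Lemma near_open_eq f g x : A x -> (forall y, A y -> f y = g y) ->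
  \forall y \near x, f y = g y.
Proof.
move=> Ax fg; have : \forall y \near x, A y.
  by apply: open_nbhs_nbhs; split => //; exact: chart_open.
by apply: filterS.
Qed.

Lemma dpart_congr i f g : (forall x, A x -> f x = g x) ->
  forall x, A x -> dpart i f x = dpart i g x.
Proof. by move=> fg x Ax; apply: near_eq_derive; exact: near_open_eq Ax fg. Qed.

Lemma dparts_congr s f g : (forall x, A x -> f x = g x) ->
  forall x, A x -> dparts s f x = dparts s g x.
Proof. by move=> fg; elim: s => //= i s; exact: dpart_congr. Qed.

Lemma dparts_rcons s i f : dparts (rcons s i) f = dparts s (dpart i f).
Proof. by rewrite /dparts foldr_rcons. Qed.

Let reg k f := forall s x, (size s <= k)%N -> A x ->
  {for x, continuous (dparts s f)} /\
  (forall i, derivable (dparts s f) x (delta_mx 0 i)).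

Let smooth_reg f : smooth_on A f <-> forall k, reg k f.
Proof. by split=> [sf k s x _|rf s x]; [exact: sf|exact: (rf (size s))]. Qed.

Let reg_congr k f g : (forall x, A x -> f x = g x) -> reg k f -> reg k g.
Proof.
move=> fg rf s x sk Ax; have [cf df] := rf s x sk Ax.
have E := dparts_congr s fg.
have N : nbhs x (fun y => dparts s f y = dparts s g y).
  exact: near_open_eq Ax E.
split=> [|i]; last by apply: (near_eq_derivable _ (df i)); exact: N.
suff : dparts s g @ x --> dparts s g x by [].
rewrite -(E x Ax); apply: cvg_trans (near_eq_cvg N) _; exact: cf.
Qed.

Let regW k f : reg k f -> reg 0 f.
Proof. by move=> rf s x s0; apply: rf; apply: leq_trans s0 _. Qed.

Let regS k f : reg 0 f -> (forall i, reg k (dpart i f)) -> reg k.+1 f.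
Proof.
move=> r0 rS s x; case/lastP: s => [_|s i]; first exact: (r0 [::]).
by rewrite size_rcons dparts_rcons; exact: rS.
Qed.

Let reg_dpart k i f : reg k.+1 f -> reg k (dpart i f).
Proof.
by move=> rf s x sk; rewrite -dparts_rcons; apply: rf; rewrite size_rcons.
Qed.

Let reg0P f : reg 0 f <-> forall x, A x ->
  f @ x --> f x /\ (forall i, derivable f x (delta_mx 0 i)).
Proof.
split=> [rf x Ax|rf [|//] x _ Ax]; last exact: rf.
by have [] := rf [::] x isT Ax.
Qed.

Let reg_cst k (c : R) : reg k (cst c).
Proof.
have r0 (d : R) : reg 0 (cst d).
  by apply/reg0P => x _; split=> [|i]; [exact: cst_continuous|exact: derivable_cst].
elim: k c => [|k IHk] c; first exact: r0.
apply: regS => [|i]; first exact: r0.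
rewrite (_ : dpart i _ = cst 0); first exact: IHk.
by apply/funext => x; exact: derive_cst.
Qed.

Let regD k f g : reg k f -> reg k g -> reg k (f + g).
Proof.
have r0 h h' : reg 0 h -> reg 0 h' -> reg 0 (h + h').
  move=> /reg0P rh /reg0P rh'; apply/reg0P => x Ax.
  have [ch dh] := rh x Ax; have [ch' dh'] := rh' x Ax.
  by split=> [|i]; [exact: (cvgD ch ch')|exact: derivableD].
elim: k f g => [|k IHk] f g rf rg; first exact: r0 rf rg.
apply: regS => [|i].
  exact: r0 (regW rf) (regW rg).
apply: (@reg_congr _ (dpart i f + dpart i g)) => [x Ax|].
  have := @deriveD R 'rV[R]_n R f g x _ ((rf [::] x isT Ax).2 i) ((rg [::] x isT Ax).2 i).
  exact: esym.
exact: IHk (reg_dpart i rf) (reg_dpart i rg).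
Qed.

Let reg_sub k f : reg k.+1 f -> reg k f.
Proof. by move=> rf s x sk; apply: rf; exact: leqW. Qed.

Let regM k f g : reg k f -> reg k g -> reg k (f * g).
Proof.
have r0 h h' : reg 0 h -> reg 0 h' -> reg 0 (h * h').
  move=> /reg0P rh /reg0P rh'; apply/reg0P => x Ax.
  have [ch dh] := rh x Ax; have [ch' dh'] := rh' x Ax.
  by split=> [|i]; [exact: (cvgM ch ch')|exact: derivableM].
elim: k f g => [|k IHk] f g rf rg; first exact: r0 rf rg.
apply: regS => [|i].
  exact: r0 (regW rf) (regW rg).
apply: (@reg_congr _ (f * dpart i g + g * dpart i f)) => [x Ax|].
  have := @deriveM R 'rV[R]_n f g x _ ((rf [::] x isT Ax).2 i) ((rg [::] x isT Ax).2 i).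
  exact: esym.
apply: regD.
  exact: IHk (reg_sub rf) (reg_dpart i rg).
exact: IHk (reg_sub rg) (reg_dpart i rf).
Qed.

Lemma smooth_on_congr f g : (forall x, A x -> f x = g x) ->
  smooth_on A f -> smooth_on A g.
Proof.
move=> fg /smooth_reg sf; apply/smooth_reg => k; exact: reg_congr fg (sf k).
Qed.

Lemma smooth_on_dpart i f : smooth_on A f -> smooth_on A (dpart i f).
Proof.
by move=> /smooth_reg sf; apply/smooth_reg => k; exact: reg_dpart (sf k.+1).
Qed.

Lemma smooth_on_derivable i f x : smooth_on A f -> A x ->
  derivable f x (delta_mx 0 i).
Proof. by move=> sf Ax; exact: (sf [::] x Ax).2 i. Qed.

Lemma smooth_on_cst (c : R) : smooth_on A (cst c).
Proof. by apply/smooth_reg => k; exact: reg_cst. Qed.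

Lemma smooth_onD f g : smooth_on A f -> smooth_on A g -> smooth_on A (f + g).
Proof.
by move=> /smooth_reg sf /smooth_reg sg; apply/smooth_reg => k; exact: regD.
Qed.

Lemma smooth_onM f g : smooth_on A f -> smooth_on A g -> smooth_on A (f * g).
Proof.
by move=> /smooth_reg sf /smooth_reg sg; apply/smooth_reg => k; exact: regM.
Qed.

Lemma smooth_onZ (c : R) f : smooth_on A f -> smooth_on A (c *: f).
Proof. by move=> sf; exact: (smooth_onM (smooth_on_cst c) sf). Qed.

Lemma smooth_fun_predP f :
  reflect (smooth_on A f /\ (forall x, ~ A x -> f x = 0))
          (f \in smooth_fun_pred U).
Proof. exact: asboolP. Qed.

Lemma zero_ext_smooth f : smooth_on A f -> zero_ext A f \in smooth_fun_pred U.
Proof.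
move=> sf; apply/smooth_fun_predP; split=> [|x]; last exact: zero_extN.
by apply: smooth_on_congr sf => x Ax; rewrite zero_extT.
Qed.

Lemma smooth_fun_submod : submod_closed (smooth_fun_pred U).
Proof.
split=> [|c f g].
  by apply/smooth_fun_predP; split=> //; exact: smooth_on_cst.
move=> /smooth_fun_predP[sf f0] /smooth_fun_predP[sg g0].
apply/smooth_fun_predP; split=> [|x nAx].
  exact: smooth_onD (smooth_onZ c sf) sg.
by rewrite /GRing.add /= /GRing.scale /= f0// g0// scaler0 addr0.
Qed.

End Open.
End SmoothFunctions.

(* C^oo(U): a function on U is represented by its extension by 0 to R^n, so
   that elements agreeing on U are equal. *)
Record smoothFun (R : realType) (n : nat) (U : chart R n) := SmoothFun {
  smooth_fun :> 'rV[R]_n -> R;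
  smooth_funP : smooth_fun \in smooth_fun_pred U }.

HB.instance Definition _ (R : realType) (n : nat) (U : chart R n) :=
  GRing.isSubmodClosed.Build R ('rV[R]_n -> R) (smooth_fun_pred U)
    (smooth_fun_submod U).
HB.instance Definition _ (R : realType) (n : nat) (U : chart R n) :=
  [isSub for @smooth_fun R n U].
HB.instance Definition _ (R : realType) (n : nat) (U : chart R n) :=
  [Choice of smoothFun U by <:].
HB.instance Definition _ (R : realType) (n : nat) (U : chart R n) :=
  [SubChoice_isSubLmodule of smoothFun U by <:].

Section SmoothFunTheory.
Variables (R : realType) (n : nat) (U : chart R n).
Implicit Types u v : smoothFun U.

Lemma smoothFun_smooth u : smooth_on U u.
Proof. by have /smooth_fun_predP[] := smooth_funP u. Qed.

Lemma smoothFun_eq u v : (forall x, chart_set U x -> u x = v x) -> u = v.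
Proof.
move=> uv; apply/val_inj/funext => x.
have [/uv//|nUx] := pselect (chart_set U x).
have /smooth_fun_predP[_ u0] := smooth_funP u.
have /smooth_fun_predP[_ v0] := smooth_funP v.
by rewrite [LHS]u0// [RHS]v0.
Qed.

Definition mk_smoothFun (f : 'rV[R]_n -> R) (sf : smooth_on U f) :
  smoothFun U := SmoothFun (zero_ext_smooth sf).

Definition smoothFun1 : smoothFun U := mk_smoothFun (smooth_on_cst (U := U) 1).

Definition partial (i : 'I_n) u : smoothFun U :=
  mk_smoothFun (smooth_on_dpart i (smoothFun_smooth u)).

Lemma mk_smoothFunE f (sf : smooth_on U f) x : chart_set U x ->
  mk_smoothFun sf x = f x.
Proof. exact: zero_extT. Qed.

Lemma partialE i u x : chart_set U x -> partial i u x = dpart i u x.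
Proof. exact: mk_smoothFunE. Qed.

Lemma smoothFunDE u v x : (u + v) x = u x + v x.
Proof. by []. Qed.

Lemma smoothFunZE (c : R) u x : (c *: u) x = c * u x.
Proof. by []. Qed.

Lemma partialP i (c : R) u v :
  partial i (c *: u + v) = c *: partial i u + partial i v.
Proof.
apply: smoothFun_eq => x Ux.
have du : derivable u x (delta_mx 0 i).
  exact: smooth_on_derivable (smoothFun_smooth u) Ux.
have dv : derivable v x (delta_mx 0 i).
  exact: smooth_on_derivable (smoothFun_smooth v) Ux.
rewrite smoothFunDE smoothFunZE !partialE//.
have := @deriveD R 'rV[R]_n R (c \*: u) v x _ (derivableZ du) dv.
by rewrite (deriveZ _ du).
Qed.

HB.instance Definition _ i :=
  GRing.isLinear.Build R (smoothFun U) (smoothFun U) *:%R (partial i)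
    (partialP i).

Lemma smoothFun_sumE (T : Type) (s : seq T) (F : T -> smoothFun U) x :
  (\sum_(t <- s) F t) x = \sum_(t <- s) F t x.
Proof. by elim/big_rec2: _ => // t a b _ <-. Qed.

Lemma dpart_sum (T : Type) (s : seq T) (c : T -> R) (u : T -> smoothFun U) i x :
  chart_set U x -> dpart i (fun y => \sum_(t <- s) c t * u t y) x =
         \sum_(t <- s) c t * partial i (u t) x.
Proof.
move=> Ux; rewrite (_ : (fun y => _) = (\sum_(t <- s) c t *: u t)); last first.
  by apply/funext => y; rewrite smoothFun_sumE.
rewrite -partialE// linear_sum smoothFun_sumE; apply: eq_bigr => t _.
by rewrite linearZ.
Qed.

End SmoothFunTheory.

Section Moyal.
Variables (R : realType) (n : nat) (theta : 'M[R]_n) (U : chart R n).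

(* theta^{ij} \partial_i \partial'_j, acting on functions w(x, x') *)
Definition bidiff (w : 'rV[R]_n -> 'rV[R]_n -> R) : 'rV[R]_n -> 'rV[R]_n -> R :=
  fun x x' => \sum_(i < n) \sum_(j < n)
    theta i j * dpart i (fun y => dpart j (w y) x') x.

Definition is_tensor (w : 'rV[R]_n -> 'rV[R]_n -> R) :=
  exists s : seq (smoothFun U * smoothFun U),
    forall x x', chart_set U x -> chart_set U x' ->
      w x x' = \sum_(p <- s) p.1 x * p.2 x'.

Lemma bidiff_tensor w : is_tensor w -> is_tensor (bidiff w).
Proof.
move=> [s ws].
exists [seq (theta ij.1 ij.2 *: partial ij.1 p.1, partial ij.2 p.2) |
  ij <- [seq (i, j) | i <- enum 'I_n, j <- enum 'I_n], p <- s].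
move=> x x' Ux Ux'; rewrite big_allpairs_dep big_allpairs_dep /=.
rewrite /bidiff big_enum; apply: eq_bigr => i _.
rewrite big_enum; apply: eq_bigr => j _.
have E y : chart_set U y ->
    dpart j (w y) x' = \sum_(p <- s) partial j p.2 x' * p.1 y.
  move=> Uy; rewrite (@dpart_congr _ _ U _ _
    (fun z => \sum_(p <- s) p.1 y * p.2 z))//; last by move=> z Uz; exact: ws.
  by rewrite dpart_sum//; apply: eq_bigr => p _; rewrite mulrC.
rewrite (dpart_congr i E Ux) dpart_sum// mulr_sumr; apply: eq_bigr => p _.
rewrite [partial j _ _ * _]mulrC mulrA; exact: erefl.
Qed.

Lemma bidiff_smooth q (u v : smoothFun U) :
  smooth_on U (fun x => (q`!%:R)^-1 *
    iter q bidiff (fun y y' => u y * v y') x x).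
Proof.
have [s ws] : is_tensor (iter q bidiff (fun y y' => u y * v y')).
  elim: q => [|q IHq]; last exact: bidiff_tensor.
  by exists [:: (u, v)] => x x' _ _; rewrite big_seq1.
apply: (@smooth_on_congr _ _ _ ((q`!%:R)^-1 *:
    (\sum_(p <- s) (p.1 : 'rV[R]_n -> R) * (p.2 : 'rV[R]_n -> R)))).
  move=> x Ux; rewrite (ws x x Ux Ux).
  have -> : \sum_(p <- s) p.1 x * p.2 x = (\sum_(p <- s)
    (p.1 : 'rV[R]_n -> R) * (p.2 : 'rV[R]_n -> R)) x by rewrite fct_sumE.
  by [].
apply: smooth_onZ; elim/big_rec: _ => [|p f _ sf].
  exact: (smooth_on_cst (U := U) 0).
apply: smooth_onD; last exact: sf.
by apply: smooth_onM; exact: smoothFun_smooth.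
Qed.

(* coefficient of hbar^q in u * v, for u, v in C^oo(U):
   the q-th term of the exponential series, restricted to x = x' *)
Definition moyal_coef (q : nat) (u v : smoothFun U) : smoothFun U :=
  mk_smoothFun (bidiff_smooth q u v).

End Moyal.

(* T[[hbar]]: the series \sum_m hbar^m a_m is the sequence of the a_m. *)
Definition formal (T : Type) : Type := nat -> T.

HB.instance Definition _ (V : zmodType) :=
  GRing.Zmodule.copy (formal V) (nat -> V).

(* action of R[[hbar]] on V[[hbar]]: Cauchy product *)
Definition hscale (R : realType) (V : lmodType R) (c : formal R)
  (f : formal V) : formal V :=
  fun m => \sum_(a < m.+1) c a *: f (m - a)%N.

Section Connection.
Variables (R : realType) (n : nat) (theta : 'M[R]_n) (U : chart R n).

Definition fsmooth : zmodType := formal (smoothFun U).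

Implicit Types (c : formal R) (f g : fsmooth) (i j k p : 'I_n).

Definition fsmooth1 : fsmooth := fun m => if m == 0%N then smoothFun1 U else 0.

Definition fpartial i f : fsmooth := fun m => partial i (f m).

(* the hbar^m coefficient collects the terms of f g and of the exponential
   whose degrees a, b and m - a - b add up to m *)
Definition star f g : fsmooth := fun m =>
  \sum_(a < m.+1) \sum_(b < (m - a).+1)
    moyal_coef theta (m - a - b) (f a) (g b).

(* T_U: V = a^i * E_i is the row of its coefficients a^i. *)
Definition tangent : zmodType := 'rV[fsmooth]_n.

Implicit Types (V W X : tangent).

Definition thscale c V : tangent := \row_j hscale c (V 0 j).

Definition lact f V : tangent := \row_j star f (V 0 j).

Definition basisE i : tangent := \row_j (if j == i then fsmooth1 else 0).

Record left_connection := LeftConnection {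
  nabla :> 'I_n -> tangent -> tangent;
  nabla_linear : forall i c V W,
    nabla i (thscale c V + W) = thscale c (nabla i V) + nabla i W;
  nabla_leibniz : forall i f V,
    nabla i (lact f V) = lact (fpartial i f) V + lact f (nabla i V) }.

Variable D : left_connection.

Definition torsion_free : Prop :=
  forall i j, D i (basisE j) = D j (basisE i).

Definition cov V X : tangent := \sum_(i < n) lact (V 0 i) (D i X).

Definition bracketEl i W : tangent := \row_j fpartial i (W 0 j).

Definition bracketEr V j : tangent := - \row_i fpartial j (V 0 i).

Definition curv i j X : tangent := D i (D j X) - D j (D i X).

(* R_{V W} X for V = E_i, where \nabla_V is \nabla_i *)
Definition curvEl i W X : tangent :=
  D i (cov W X) - cov W (D i X) - cov (bracketEl i W) X.

(* R_{V W} X for W = E_j *)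
Definition curvEr V j X : tangent :=
  cov V (D j X) - D j (cov V X) - cov (bracketEr V j) X.

(* (\nabla_k R)_{E_i E_j} E_p *)
Definition cov_curv k i j p : tangent :=
  D k (curv i j (basisE p)) - curvEr (D k (basisE i)) j (basisE p)
  - curvEl i (D k (basisE j)) (basisE p) - curv i j (D k (basisE p)).

End Connection.

(* Main.v *)
(** Since [V, E_j] = - [E_j, V], and since the star product is odd in its left
    factor, the curvature operators satisfy R_{V E_j} = - R_{E_j V}.  Hence, for a
    torsion free connection, the terms of the second Bianchi identity that
    involve nabla_k E_i cancel in pairs, and what is left is the Jacobi identity
    for the commutators of the additive maps nabla_i. *)

Require Import Defs.
From mathcomp Require Import all_boot all_order all_algebra.
From mathcomp Require Import all_classical all_reals all_analysis.

Import GRing.Theory.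
Local Open Scope ring_scope.

Section ZmodIdentities.
Variable V : zmodType.
Implicit Types a b c x y z : V.

Lemma subr_cycle a b c : a - b + (b - c) + (c - a) = 0.
Proof. by rewrite !addrA !subrK subrr. Qed.

(** The letters [a], [b], [c] stand for the even and [x], [y], [z] for the odd orderings of three
    composed operators. *)
Lemma subr_jacobi a b c x y z :
  a - x - (b - y) + (b - z - (c - x)) + (c - y - (a - z)) = 0.
Proof.
have swap p q r s : p - q - (r - s) = (p - r) + (s - q) :> V.
  by rewrite opprB [s - r]addrC addrACA [- q + s]addrC.
(* Each of the two triples now telescopes around its own cycle. *)
by rewrite !swap [X in X + _ = _]addrACA [LHS]addrACA !subr_cycle addr0.
Qed.

(** The double negations come from the skew-symmetry of the curvature; each correction term [x],
    [y], [z] occurs once with either sign. *)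
Lemma subr_cycle_cancel a b c a' b' c' x y z :
  a - - x - y - a' + (b - - z - x - b') + (c - - y - z - c') =
  (a - a') + (b - b') + (c - c').
Proof.
have regroup p q r s : p - - q - r - s = (p - s) + (q - r) :> V.
  by rewrite opprK -[p + q - r]addrA addrAC.
rewrite !regroup [X in X + _ = _]addrACA [LHS]addrACA.
by rewrite [X in _ + (X + _)]addrC subr_cycle addr0.
Qed.

End ZmodIdentities.

Section StarOpp.
Variables (R : realType) (n : nat) (theta : 'M[R]_n) (U : chart R n).
Implicit Types (w : 'rV[R]_n -> 'rV[R]_n -> R) (u v : smoothFun U).

Lemma smoothFunNE u x : (- u) x = - u x.
Proof. by rewrite -scaleN1r smoothFunZE mulN1r. Qed.

Lemma iter_bidiff_tensor q w :
  is_tensor U w -> is_tensor U (iter q (bidiff theta) w).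
Proof. by move=> tw; elim: q => //= q; exact: bidiff_tensor. Qed.

(* Tensors have the partial derivatives needed here; ['D_v] of a function that
   is not derivable is a junk value that need not be odd. *)
Lemma bidiffN w w' : is_tensor U w ->
  (forall x x', chart_set U x -> chart_set U x' -> w' x x' = - w x x') ->
  forall x x', chart_set U x -> chart_set U x' ->
    bidiff theta w' x x' = - bidiff theta w x x'.
Proof.
move=> [s ws] w'N x x' Ux Ux'; rewrite /bidiff -sumrN.
apply: eq_bigr => i _; rewrite -sumrN; apply: eq_bigr => j _.
have E y : chart_set U y ->
    dpart j (w y) x' = \sum_(p <- s) partial j p.2 x' * p.1 y.
  move=> Uy; rewrite (dpart_congr j (ws y ^~ Uy) Ux') dpart_sum//.
  by apply: eq_bigr => p _; rewrite mulrC.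
have E' y : chart_set U y ->
    dpart j (w' y) x' = \sum_(p <- s) - partial j p.2 x' * p.1 y.
  move=> Uy; rewrite (@dpart_congr _ _ U _ _
    (fun z => \sum_(p <- s) - p.1 y * p.2 z))//; last first.
    move=> z Uz; rewrite w'N// ws// -sumrN.
    by apply: eq_bigr => p _; rewrite mulNr.
  by rewrite dpart_sum//; apply: eq_bigr => p _; rewrite !mulNr mulrC.
rewrite (dpart_congr i E Ux) (dpart_congr i E' Ux) !dpart_sum// -mulrN -sumrN.
by congr (_ * _); apply: eq_bigr => p _; rewrite mulNr.
Qed.

Lemma moyal_coefNl q u v :
  moyal_coef theta q (- u) v = - moyal_coef theta q u v.
Proof.
have tuv : is_tensor U (fun y y' => u y * v y').
  by exists [:: (u, v)] => x x' _ _; rewrite big_seq1.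
apply: smoothFun_eq => x Ux; rewrite smoothFunNE !mk_smoothFunE// -mulrN.
(* Since [bidiff] differentiates in the two variables separately, the induction has to run off the
   diagonal. *)
congr (_ * _); suff iterN y y' : chart_set U y -> chart_set U y' ->
    iter q (bidiff theta) (fun z z' => (- u) z * v z') y y' =
    - iter q (bidiff theta) (fun z z' => u z * v z') y y' by exact: iterN.
elim: q y y' => [|q IHq] y y' Uy Uy'; first exact: mulNr.
by apply: bidiffN => //; exact: iter_bidiff_tensor.
Qed.

Lemma starNl (f g : fsmooth U) : star theta (- f) g = - star theta f g.
Proof.
apply/funext => m; rewrite /star [RHS]/GRing.opp /= -sumrN.
apply: eq_bigr => a _; rewrite -sumrN; apply: eq_bigr => b _.
exact: moyal_coefNl.
Qed.

Lemma lactNl (f : fsmooth U) (V : tangent U) :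
  lact theta (- f) V = - lact theta f V.
Proof. by apply/rowP => j; rewrite !mxE starNl. Qed.

Lemma covNl (D : left_connection theta U) V X : cov D (- V) X = - cov D V X.
Proof. by rewrite /cov -sumrN; apply: eq_bigr => i _; rewrite mxE lactNl. Qed.

End StarOpp.

Section Curvature.
Variables (R : realType) (n : nat) (theta : 'M[R]_n) (U : chart R n).
Variable D : left_connection theta U.
Implicit Types (V W X : tangent U) (i j k : 'I_n).

(** The sequence 1, 0, 0, ... is the unit of R[[hbar]]; taking it as scalar in [nabla_linear] gives
    additivity. *)
Lemma thscale1 V : thscale (fun m => (m == 0)%:R) V = V.
Proof.
apply/rowP => j; rewrite mxE; apply/funext => m.
rewrite /hscale big_ord_recl scale1r subn0 big1 ?addr0// => a _.
by rewrite scale0r.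
Qed.

Lemma nablaD i : {morph D i : V W / V + W}.
Proof. by move=> V W; rewrite -{1}(thscale1 V) nabla_linear thscale1. Qed.

Lemma nablaB i : {morph D i : V W / V - W}.
Proof. by move=> V W; apply/eqP; rewrite eq_sym subr_eq -nablaD subrK. Qed.

Lemma curvEr_skew V j X : curvEr D V j X = - curvEl D j V X.
Proof. by rewrite /curvEr /bracketEr covNl /curvEl !opprB opprK addrC. Qed.

Lemma curv_jacobi i j k X :
  (D i (curv D j k X) - curv D j k (D i X))
  + (D j (curv D k i X) - curv D k i (D j X))
  + (D k (curv D i j X) - curv D i j (D k X)) = 0.
Proof. by rewrite /curv !nablaB; exact: subr_jacobi. Qed.

(** By torsion freeness only three second derivatives occur, nabla_i nabla_j E_k, nabla_j nabla_i
    E_k and nabla_k nabla_i E_j, and their differences telescope. *)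
Lemma first_bianchi : torsion_free D -> forall i j k,
  curv D i j (basisE U k) + curv D j k (basisE U i)
  + curv D k i (basisE U j) = 0.
Proof.
move=> tf i j k; rewrite /curv (tf k i) (tf j i) (tf k j).
exact: subr_cycle.
Qed.

Lemma second_bianchi : torsion_free D -> forall i j k p,
  cov_curv D i j k p + cov_curv D j k i p + cov_curv D k i j p = 0.
Proof.
(* With 0 replaced by the Jacobi sum at E_p, only the correction terms remain to be cancelled. *)
move=> tf i j k p; rewrite -(curv_jacobi i j k (basisE U p)) /cov_curv.
(* The corrections reduce to R_{E_k W} with W = nabla_i E_j, R_{E_j W} with W = nabla_i E_k, and
   R_{E_i W} with W = nabla_j E_k. *)
rewrite !curvEr_skew (tf k i) (tf j i) (tf k j).
exact: subr_cycle_cancel.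
Qed.

End Curvature.

Theorem theorem3p1 (R : realType) (n : nat) (theta : 'M[R]_n)
    (U : chart R n) (D : left_connection theta U) :
  theta^T = - theta ->
  torsion_free D ->
  (forall i j k : 'I_n,
     curv D i j (basisE U k) + curv D j k (basisE U i)
     + curv D k i (basisE U j) = 0) /\
  (forall i j k p : 'I_n,
     cov_curv D i j k p + cov_curv D j k i p + cov_curv D k i j p = 0).
Proof. by move=> _ tf; split; [exact: first_bianchi|exact: second_bianchi]. Qed.
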